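(* Let $G_S$ be a self-loop graph of order $N$ with $|S|\ge1$ and let $\widetilde G$ be its Açıkmeşe lift. Let $q>0$ and $c\in\mathbb{R}$, and let $e_1\ge e_2\ge\cdots\ge e_{2N+1}\ge0$ be the eigenvalues (with multiplicity) of $\Phi_q(\mathcal{L}(\widetilde G),c)$ in non-increasing order. Then $$\sum_{i=N+1}^{2N+1}e_i-\sum_{i=1}^{N}e_i\;\le\;\mathcal{M}_q(M_{sym},c)-\mathcal{M}_q(\mathcal{L}(G_S),c)\;\le\;\sum_{i=1}^{N+1}e_i-\sum_{i=N+2}^{2N+1}e_i.$$
   Context: Let $G$ be a finite undirected simple graph with vertex set $V=\{1,\dots,N\}$ (possibly disconnected), and $S\subseteq V$. The self-loop graph $G_S$ is obtained from $G$ by attaching one loop at every vertex of $S$; $\sigma=|S|$. The loop vector $s\in\mathbb{R}^N$ is the indicator vector of $S$. $\mathcal{L}(G)=D(G)-A(G)$ is the ordinary Laplacian and $\mathcal{L}(G_S):=\mathcal{L}(G)+\mathrm{diag}(s)$. For $\sigma\ge1$, the Açıkmeşe lift $\widetilde G=(\widetilde V,\widetilde E)$ of $G_S$ is the simple graph on $\widetilde V=\{1,\dots,2N+1\}$ such that: for each edge $\{i,j\}$ of $G$, both $\{i,j\}$ and $\{i+N+1,j+N+1\}$ are edges of $\widetilde G$; for each $i\in S$, both $\{i,N+1\}$ and $\{N+1,i+N+1\}$ are edges; there are no other edges. $\mathcal{L}(\widetilde G)$ is the ordinary Laplacian of $\widetilde G$. $M_{sym}=\begin{pmatrix}2\sigma&-\sqrt2\,s^\top\\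 -\sqrt2\,s&\mathcal{L}(G_S)\end{pmatrix}\in\mathbb{R}^{(N+1)\times(N+1)}$. For a real symmetric matrix $B$ of order $r$ with eigenvalues $\lambda_1(B),\dots,\lambda_r(B)$ (with multiplicity), $\mathcal{M}_q(B,c)=\sum_{i=1}^r|\lambda_i(B)-c|^q$, and $\Phi_q(B,c)=|B-cI_r|^q$ is defined by spectral functional calculus (apply $x\mapsto|x-c|^q$ to $B$). *)

(* Defs.v *)
From HB Require Import structures.
From mathcomp Require Import all_boot all_order all_algebra.
From mathcomp Require Import polyrcf.
From mathcomp Require Import reals exp.
From mathcomp Require Import zify.

Set Implicit Arguments.
Unset Strict Implicit.
Unset Printing Implicit Defensive.

Import Order.TTheory GRing.Theory Num.Theory.

Local Open Scope ring_scope.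

Record sgraph (n : nat) := SGraph {
  sedge :> rel 'I_n;
  sedge_sym : symmetric sedge;
  sedge_irrefl : irreflexive sedge }.

Section Laplacians.
Variables (R : realType) (n : nat).

Definition adjacency_mx (G : sgraph n) : 'M[R]_n := \matrix_(i, j) (G i j)%:R.

Definition degree_mx (G : sgraph n) : 'M[R]_n :=
  diag_mx (\row_i #|[set j | G i j]|%:R).

Definition laplacian (G : sgraph n) : 'M[R]_n := degree_mx G - adjacency_mx G.

Definition loop_vec (S : {set 'I_n}) : 'cV[R]_n := \col_i (i \in S)%:R.

Definition loop_laplacian (G : sgraph n) (S : {set 'I_n}) : 'M[R]_n :=
  laplacian G + diag_mx (loop_vec S)^T.

Definition M_sym (G : sgraph n) (S : {set 'I_n}) : 'M[R]_(1 + n) :=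
  block_mx (2 * #|S|%:R)%:M                    (- (Num.sqrt 2 *: (loop_vec S)^T))
           (- (Num.sqrt 2 *: loop_vec S))      (loop_laplacian G S).

End Laplacians.

(* The vertices of the lift are listed as: first copy of V, middle vertex,
   second copy of V; i.e. with 0-based indices i < N, N, and i + N + 1. *)
Section Lift.
Variables (N : nat) (G : sgraph N) (S : {set 'I_N}).

Definition fst_copy (i : 'I_N) : 'I_(N + (1 + N)) := lshift (1 + N) i.
Definition mid_vertex : 'I_(N + (1 + N)) := rshift N (lshift N ord0).
Definition snd_copy (i : 'I_N) : 'I_(N + (1 + N)) := rshift N (rshift 1 i).

Definition lift_edge : rel 'I_(N + (1 + N)) := fun u v =>
  [exists i, exists j, G i j &&
     ([&& u == fst_copy i & v == fst_copy j]
      || [&& u == snd_copy i & v == snd_copy j])]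
  || [exists i in S,
       [|| [&& u == fst_copy i & v == mid_vertex],
           [&& u == mid_vertex & v == fst_copy i],
           [&& u == mid_vertex & v == snd_copy i]
         | [&& u == snd_copy i & v == mid_vertex]]].

Lemma lift_edge_sym : symmetric lift_edge.
Proof.
suff sub u v : lift_edge u v -> lift_edge v u.
  by move=> u v; apply/idP/idP; apply: sub.
case/orP=> [/existsP[i /existsP[j /andP[Gij uv]]] | /existsP[i /andP[iS uv]]].
  apply/orP; left; apply/existsP; exists j; apply/existsP; exists i.
  by rewrite sedge_sym Gij /=; case/orP: uv => /andP[-> ->]; rewrite ?orbT.
apply/orP; right; apply/existsP; exists i; rewrite iS /=.
by case/or4P: uv => /andP[-> ->]; rewrite ?orbT.
Qed.

Lemma lift_edge_irrefl : irreflexive lift_edge.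
Proof.
move=> u; apply/negP.
case/orP=> [/existsP[i /existsP[j /andP[Gij uv]]] | /existsP[i /andP[_ uv]]].
  have ij : i = j.
    case/orP: uv => /andP[/eqP-> /eqP].
      exact: lshift_inj.
    by move/rshift_inj/rshift_inj.
  by rewrite ij sedge_irrefl in Gij.
have disj k1 k2 : u == k1 -> u == k2 -> k1 = k2 by move=> /eqP<- /eqP.
case/or4P: uv => /andP[h1 h2]; have /(congr1 val)/= := disj _ _ h1 h2;
  by move: (ltn_ord i) => /= ? ?; lia.
Qed.

Definition acikmese_lift : sgraph (N + (1 + N)) :=
  SGraph lift_edge_sym lift_edge_irrefl.

End Lift.

Section SymmetricSpectra.
Variable R : realType.

(* Real eigenvalues, each repeated according to its multiplicity as a root of
   the characteristic polynomial, in non-increasing order ([rootsR p] lists the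
   distinct real roots of [p] in increasing order). For a symmetric matrix of
   order n these are all the eigenvalues, so the sequence has length n. *)
Definition eigenvalues (n : nat) (B : 'M[R]_n) : seq R :=
  flatten [seq nseq (mup x (char_poly B)) x | x <- rev (rootsR (char_poly B))].

(* Matrix (acting on row vectors) of the orthogonal projection onto the
   eigenspace of B for x; [kermx V^T] is the orthogonal complement of [V]. *)
Definition eigenproj (n : nat) (B : 'M[R]_n) (x : R) : 'M[R]_n :=
  proj_mx (eigenspace B x) (kermx (eigenspace B x)^T).

(* f(B) = \sum_x f(x) P_x over the distinct eigenvalues x of a symmetric B. *)
Definition spectral_fun (n : nat) (f : R -> R) (B : 'M[R]_n) : 'M[R]_n :=
  \sum_(x <- rootsR (char_poly B)) f x *: eigenproj B x.

Definition Phi (n : nat) (q : R) (B : 'M[R]_n) (c : R) : 'M[R]_n :=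
  spectral_fun (fun x => `|x - c| `^ q) B.

Definition moment (n : nat) (q : R) (B : 'M[R]_n) (c : R) : R :=
  \sum_(x <- eigenvalues B) `|x - c| `^ q.

End SymmetricSpectra.

(* Main.v *)
Require Import Defs.
From mathcomp Require Import all_boot all_order all_algebra.
From mathcomp Require Import polyrcf complex.
From mathcomp Require Import reals exp.
From mathcomp Require Import lra.

(** The lift consists of two copies of [G] joined through one middle vertex, and
exchanging the two copies is a symmetry of it. Splitting vectors on the lift
into an antisymmetric part [(x, 0, - x)] and a symmetric part
[(x / sqrt 2, t, x / sqrt 2)] therefore block-diagonalizes its Laplacian. On the
antisymmetric part the middle vertex carries the value 0, so an edge to it acts
as a loop and the Laplacian restricts to that of [G_S]; on the symmetric part it
restricts to [M_sym], the factor [sqrt 2] coming from the normalization. Hence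
the spectrum of the lift is the disjoint union of the spectra of [G_S] ([N]
eigenvalues) and of [M_sym] ([N + 1] eigenvalues), counted with multiplicity
([char_poly_lift]).

A real symmetric matrix is diagonalizable with orthogonal eigenspaces, so
[spectral_fun f B] is diagonalized by the same basis as [B], and its eigenvalues
are the images under [f] of those of [B] ([perm_eigenvalues_spectral_fun]).
Applied to [x |-> |x - c| ^ q], this makes the sorted list [e] a rearrangement of
[a ++ b], where the entries of [a] sum to the moment of the loop Laplacian and
those of [b] to the moment of [M_sym].

What is left is a fact about sorted lists: among all ways to cut [e] into two
parts of given sizes, the difference of the sums is largest when one part takes
the largest entries ([sum_difference_le_take_drop]). Giving the largest entries
to [b] yields the upper bound, giving them to [a] the lower one. *)

Set Implicit Arguments.
Unset Strict Implicit.
Unset Printing Implicit Defensive.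

Import Order.TTheory GRing.Theory Num.Theory.

Local Open Scope ring_scope.

(** * Diagonalization of real symmetric matrices *)

Lemma char_poly_similar (F : fieldType) n (P A B : 'M[F]_n) :
  P \in unitmx -> P *m A = B *m P -> char_poly A = char_poly B.
Proof.
move=> Pu PA; have dP : \det (map_mx polyC P) != 0.
  by rewrite det_map_mx polyC_eq0 -unitfE -unitmxE.
apply: (mulfI dP); rewrite [RHS]mulrC -!det_mulmx; congr (\det _).
by rewrite mulmxBr mulmxBl scalar_mxC -!map_mxM PA.
Qed.

(** Over the complex extension of [R] a symmetric real matrix is Hermitian, hence
similar to a real diagonal matrix. Two real matrices that are similar over the
complex numbers are already similar through a real matrix: if [P + 'i *: Q] is an
invertible intertwiner, then so is [P + a *: Q] for all but finitely many real [a]. *)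
Lemma symmetric_diagonalizable (R : rcfType) n (B : 'M[R]_n) :
  B^T = B -> exists P (d : 'rV[R]_n), P \in unitmx /\ P *m B = diag_mx d *m P.
Proof.
move=> Bsym; pose toC := map_mx (@real_complex_def R (Phant R)).
have toC_real k l (M : 'M[R]_(k, l)) : toC k l M \is a mxOver Num.real.
  by apply/mxOverP => i j; rewrite mxE; apply/complex_realP; exists (M i j).
have toC_Re k l (M : 'M_(k, l)) :
    M \is a mxOver Num.real -> toC k l (map_mx (@complex.Re R) M) = M.
  by move=> /mxOverP Mre; apply/matrixP => i j; rewrite !mxE RRe_real.
pose A := toC _ _ B.
have Aherm : A \is hermsymmx.
  apply: realsym_hermsym; rewrite ?toC_real//; apply/is_hermitianmxP.
  by rewrite expr0 scale1r map_mx_id// map_trmx Bsym.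
have Aspec := orthomx_spectralP (hermitian_normalmx Aherm).
have Dreal := hermitian_spectral_diag_real Aherm.
set D := spectral_diag A in Dreal Aspec.
have [|||P] := @real_similar _ _ A (diag_mx D).
- exists (spectralmx A); first exact: spectral_unit.
  apply/similarP; first exact: spectral_unit.
  by rewrite {2}Aspec !mulmxA mulmxV ?spectral_unit// mul1mx.
- exact: toC_real.
- by apply/mxOverP => i j; rewrite mxE rpredMn// (mxOverP Dreal).
rewrite inE => /andP[Preal Pu] /(similarP Pu) PA.
exists (map_mx (@complex.Re R) P), (map_mx (@complex.Re R) D); split.
  by rewrite -(map_unitmx (@real_complex_def R (Phant R))) -/(toC _ _ _) toC_Re.
apply: (map_mx_inj (f := @real_complex_def R (Phant R))).
by rewrite !map_mxM map_diag_mx -!/(toC _ _ _) !toC_Re.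
Qed.

Lemma char_poly_diagonalized (F : fieldType) n (P A : 'M[F]_n) (d : 'rV_n) :
  P \in unitmx -> P *m A = diag_mx d *m P ->
  char_poly A = \prod_(x <- [seq d 0 i | i : 'I_n]) ('X - x%:P).
Proof.
move=> Pu /(char_poly_similar Pu) ->; rewrite char_poly_trig ?diag_mx_is_trig//.
by rewrite big_image /=; apply: eq_bigr => i _; rewrite mxE eqxx.
Qed.

Lemma mem_rootsR (R : rcfType) (p : {poly R}) x : p != 0 -> (x \in rootsR p) = root p x.
Proof. by move=> p0; rewrite -(roots_on_rootsR p0) in_itv. Qed.

Section Eigenvalues.
Variable R : realType.

Lemma eigenvalues_sorted n (B : 'M[R]_n) : sorted >=%R (eigenvalues B).
Proof.
rewrite /eigenvalues; have: sorted >%R (rev (rootsR (char_poly B))).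
  by rewrite rev_sorted sorted_roots.
elim: (rev _) => //= x s IHs xs.
have ge_tr : transitive (>=%R : rel R) by move=> a b c /= ba ac; apply: le_trans ba.
have gt_tr : transitive (>%R : rel R) by move=> a b c /= ba ac; apply: lt_trans ba.
rewrite (sorted_pairwise ge_tr) pairwise_cat -!(sorted_pairwise ge_tr).
apply/and3P; split; last by apply: IHs; apply: path_sorted xs.
  apply/allrelP => y z /nseqP[-> _] /flattenP[_ /mapP[w ws ->]] /nseqP[-> _].
  by apply: ltW; have /allP/(_ _ ws) := order_path_min gt_tr xs.
by case: (mup _ _) => //= m; elim: m => //= m ->; rewrite lexx.
Qed.

(** Both sides list each [y] as often as [y] is a root of the characteristic
polynomial. *)
Lemma perm_eigenvalues n (B : 'M[R]_n) (s : seq R) :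
  char_poly B = \prod_(x <- s) ('X - x%:P) -> perm_eq (eigenvalues B) s.
Proof.
move=> Bs; have B0 := monic_neq0 (char_poly_monic B).
apply/allP => y _ /=; rewrite -(mu_prod_XsubC y s) -Bs /eigenvalues.
rewrite count_flatten -map_comp; apply/eqP.
transitivity (\sum_(x <- rootsR (char_poly B)) (x == y) * mup x (char_poly B))%N.
  rewrite sumnE big_map (perm_big (rootsR (char_poly B))) ?perm_rev//=.
  by apply: eq_bigr => x _; rewrite count_nseq.
have [yB|yNB] := boolP (root (char_poly B) y).
  rewrite (bigD1_seq y) ?mem_rootsR ?uniq_roots//= eqxx mul1n big1 ?addn0//.
  by move=> x /negPf ->.
rewrite mupNroot// big_seq big1// => x; rewrite mem_rootsR// => xB.
by case: eqP => // xy; rewrite xy (negPf yNB) in xB.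
Qed.

End Eigenvalues.

(** * Spectral functions of symmetric matrices *)

Lemma row_mul_trmx_eq0 (R : realFieldType) n (u : 'rV[R]_n) : u *m u^T = 0 -> u = 0.
Proof.
move=> /(congr1 (fun M : 'M_1 => M 0 0)); rewrite !mxE => u0.
apply/rowP => i; rewrite [RHS]mxE; apply/eqP; rewrite -sqrf_eq0.
have /eqP := u0; rewrite psumr_eq0; last by move=> j _; rewrite mxE -expr2 sqr_ge0.
by move=> /allP/(_ i (mem_index_enum _))/=; rewrite mxE.
Qed.

Lemma capmx_orthogonal (R : realFieldType) n (V : 'M[R]_n) : (V :&: kermx V^T = 0)%MS.
Proof.
apply/eqP; rewrite -submx0; apply/rV_subP => u; rewrite sub_capmx.
case/andP=> /submxP[w ->] /sub_kermxP wVV; rewrite submx0; apply/eqP.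
by apply: row_mul_trmx_eq0; rewrite trmx_mul mulmxA wVV mul0mx.
Qed.

(** For a symmetric [B] and [u *m B = x *: u], [V *m B = y *: V], moving [B] from
one side of [u *m V^T] to the other gives [x *: (u *m V^T) = y *: (u *m V^T)]. *)
Lemma eigenspace_orthogonal (F : fieldType) n (B : 'M[F]_n) (u : 'rV_n) x y :
  B^T = B -> x != y -> (u <= eigenspace B x)%MS ->
  (u <= kermx (eigenspace B y)^T)%MS.
Proof.
move=> Bsym xy /eigenspaceP uB; apply/sub_kermxP.
have VB : eigenspace B y *m B = y *: eigenspace B y by exact/eigenspaceP.
have /eqP : x *: (u *m (eigenspace B y)^T) = y *: (u *m (eigenspace B y)^T).
  by rewrite scalemxAl -uB -mulmxA -{1}Bsym -trmx_mul VB linearZ /= scalemxAr.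
by rewrite -subr_eq0 -scalerBl scaler_eq0 subr_eq0 (negPf xy) => /eqP.
Qed.

Section SpectralFunctions.
Variable R : realType.

(** Each row of [P] is an eigenvector of [B]. By orthogonality of the eigenspaces,
the projection onto its own eigenspace fixes it and all the other projections kill
it, so [spectral_fun f B] multiplies it by the image of its eigenvalue. *)
Lemma spectral_fun_diagonalized n (f : R -> R) (B P : 'M[R]_n) (d : 'rV_n) :
  B^T = B -> P \in unitmx -> P *m B = diag_mx d *m P ->
  P *m spectral_fun f B = diag_mx (map_mx f d) *m P.
Proof.
move=> Bsym Pu PB; have B0 := monic_neq0 (char_poly_monic B).
apply/row_matrixP => i.
have PiB : row i P *m B = d 0 i *: row i P.
  by rewrite -row_mul PB row_mul row_diag_mx -scalemxAl -rowE.
have Pid : (row i P <= eigenspace B (d 0 i))%MS by apply/eigenspaceP.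
rewrite [RHS]row_mul row_diag_mx -scalemxAl -rowE mxE row_mul.
have diB : d 0 i \in rootsR (char_poly B).
  rewrite mem_rootsR// (char_poly_diagonalized Pu PB) root_prod_XsubC.
  exact: image_f.
rewrite /spectral_fun (bigD1_seq (d 0 i)) ?uniq_roots//= mulmxDr.
rewrite -scalemxAr proj_mx_id ?capmx_orthogonal// mulmx_sumr big1 ?addr0// => x xd.
rewrite -scalemxAr proj_mx_0 ?scaler0 ?capmx_orthogonal//.
by apply: eigenspace_orthogonal Pid => //; rewrite eq_sym.
Qed.

Lemma char_poly_symmetric n (B : 'M[R]_n) : B^T = B ->
  char_poly B = \prod_(x <- eigenvalues B) ('X - x%:P).
Proof.
case/symmetric_diagonalizable => P [d [Pu PB]].
have cB := char_poly_diagonalized Pu PB.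
by rewrite (perm_big _ (perm_eigenvalues cB)).
Qed.

Lemma size_eigenvalues n (B : 'M[R]_n) : B^T = B -> size (eigenvalues B) = n.
Proof.
move=> /char_poly_symmetric/(congr1 (fun p : {poly R} => size p)).
by rewrite size_char_poly size_prod_XsubC => -[].
Qed.

Lemma perm_eigenvalues_spectral_fun n (f : R -> R) (B : 'M[R]_n) : B^T = B ->
  perm_eq (eigenvalues (spectral_fun f B)) [seq f x | x <- eigenvalues B].
Proof.
move=> Bsym; have [P [d [Pu PB]]] := symmetric_diagonalizable Bsym.
have fB := spectral_fun_diagonalized f Bsym Pu PB.
apply: (perm_trans (perm_eigenvalues (char_poly_diagonalized Pu fB))).
rewrite perm_sym; have := perm_eigenvalues (char_poly_diagonalized Pu PB).
move/(perm_map f)/perm_trans; apply; rewrite -map_comp.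
rewrite -map_comp (@eq_map _ _ _ (fun i => map_mx f d 0 i)) => [|i]; last by rewrite mxE.
by rewrite /image_mem ?enumT perm_refl.
Qed.

End SpectralFunctions.

(** * Sums over parts of a sorted list *)

(** Let [t] be the smallest of the [size a] largest entries. After subtracting [t]
from every entry, the right-hand side is the sum of all the positive parts over
[s], while the left-hand side adds up only some entries of [s]. *)
Lemma sum_le_take (R : realFieldType) (s a b : seq R) :
  sorted >=%R s -> perm_eq s (a ++ b) ->
  \sum_(x <- a) x <= \sum_(x <- take (size a) s) x.
Proof.
move=> s_sorted sab.
have ge_refl : reflexive (>=%R : rel R) by move=> x /=.
have ge_tr : transitive (>=%R : rel R).
  by move=> x y z /= xy zx; apply: le_trans xy.
have [a0 | a_gt0] := posnP (size a).
  by rewrite a0 take0 (size0nil a0) !big_nil.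
have a_le_s : (size a <= size s)%N by rewrite (perm_size sab) size_cat leq_addr.
set t := nth 0 s (size a).-1.
have sumBt (l : seq R) : \sum_(x <- l) x = \sum_(x <- l) (x - t) + t *+ size l.
  by rewrite sumrB big_const_seq count_predT iter_addr_0 subrK.
rewrite sumBt [leRHS]sumBt size_takel// lerD2r.
(* Entries of [take] lie above [t], so their positive parts are exact; those of
   [drop] lie below [t] and contribute nothing. *)
pose pos x := Num.max 0 (x - t).
have pos_ge0 x : 0 <= pos x by rewrite le_max lexx.
apply: (@le_trans _ _ (\sum_(x <- s) pos x)).
  rewrite (perm_big _ sab) big_cat/= -[leLHS]addr0 lerD ?sumr_ge0//.
  by apply: ler_sum => x _; rewrite le_max lexx orbT.
rewrite -{1}(cat_take_drop (size a) s) big_cat/=.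
rewrite [X in _ + X]big_seq [X in _ + X]big1 ?addr0 => [|x]; last first.
  move=> /(nthP 0)[k]; rewrite size_drop nth_drop => k_lt <-.
  apply/max_idPl; rewrite subr_le0.
  apply: (sorted_leq_nth ge_tr ge_refl 0 s_sorted); rewrite ?inE.
  - by rewrite prednK.
  - by rewrite -ltn_subRL.
  - by rewrite (leq_trans (leq_pred _))// leq_addr.
rewrite !big_seq ler_sum// => x /(nthP 0)[k]; rewrite size_takel// => k_lt.
rewrite nth_take// => <-; rewrite ge_max lexx andbT subr_ge0.
apply: (sorted_leq_nth ge_tr ge_refl 0 s_sorted); rewrite ?inE.
- exact: leq_trans k_lt a_le_s.
- by rewrite prednK.
- by rewrite -ltnS prednK.
Qed.

(** As the sum over the whole of [s] is the same for every cut, the difference is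
an increasing function of the sum of [b] alone. *)
Lemma sum_difference_le_take_drop (R : realFieldType) (s a b : seq R) :
  sorted >=%R s -> perm_eq s (a ++ b) ->
  \sum_(x <- b) x - \sum_(x <- a) x
    <= \sum_(x <- take (size b) s) x - \sum_(x <- drop (size b) s) x.
Proof.
move=> s_sorted sab; have sba : perm_eq s (b ++ a).
  by rewrite (perm_trans sab)// perm_catC.
have b_le := sum_le_take s_sorted sba.
have total : \sum_(x <- take (size b) s) x + \sum_(x <- drop (size b) s) x
           = \sum_(x <- a) x + \sum_(x <- b) x.
  by rewrite -!big_cat cat_take_drop; apply: perm_big.
lra.
Qed.

Lemma sum_nth_take (V : nmodType) (s : seq V) m : (m <= size s)%N ->
  \sum_(0 <= k < m) s`_k = \sum_(x <- take m s) x.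
Proof.
move=> m_le; rewrite [RHS](big_nth 0) size_takel// !big_nat.
by apply: eq_bigr => k /andP[_ k_lt]; rewrite nth_take.
Qed.

Lemma sum_nth_drop (V : nmodType) (s : seq V) m :
  \sum_(m <= k < size s) s`_k = \sum_(x <- drop m s) x.
Proof.
rewrite [RHS](big_nth 0) size_drop -{1}[m]add0n big_addn.
by apply: eq_bigr => k _; rewrite nth_drop addnC.
Qed.

(** * The Laplacian of the lift *)

Section Lift.
Variables (R : realType) (N : nat) (G : sgraph N) (S : {set 'I_N}).
Let s := loop_vec R S.
Let A := adjacency_mx R G.
Let L := loop_laplacian R G S.

(** Degrees as row sums of the adjacency matrix: this turns the computation of the
Laplacian of the lift into a product of block matrices. *)
Lemma laplacianE n (H : sgraph n) :
  laplacian R H = diag_mx (adjacency_mx R H *m const_mx 1 : 'cV_n)^T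
                  - adjacency_mx R H.
Proof.
rewrite /laplacian; congr (diag_mx _ - _); apply/rowP => i.
rewrite !mxE -sum1_card natr_sum big_mkcond/=.
by apply: eq_bigr => j _; rewrite !mxE inE mulr1; case: (H i j).
Qed.

Lemma trmx_adjacency n (H : sgraph n) : (adjacency_mx R H)^T = adjacency_mx R H.
Proof. by apply/matrixP => i j; rewrite !mxE sedge_sym. Qed.

Lemma trmx_laplacian n (H : sgraph n) : (laplacian R H)^T = laplacian R H.
Proof. by rewrite /laplacian linearB/= tr_diag_mx trmx_adjacency. Qed.

Lemma trmx_loop_laplacian : L^T = L.
Proof. by rewrite /L /loop_laplacian linearD/= tr_diag_mx trmx_laplacian. Qed.

Lemma trmx_M_sym : (M_sym R G S)^T = M_sym R G S.
Proof.
rewrite /M_sym tr_block_mx tr_scalar_mx trmx_loop_laplacian.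
by rewrite !linearN !linearZ/= trmxK.
Qed.

Let f := @fst_copy N.
Let m := mid_vertex N.
Let g := @snd_copy N.

Lemma copy_eq :
  (forall i j, (f i == f j) = (i == j)) * (forall i j, (g i == g j) = (i == j)) *
  (forall i j, (f i == g j) = false) * (forall i j, (g i == f j) = false) *
  (forall i, (f i == m) = false) * (forall i, (m == f i) = false) *
  (forall i, (g i == m) = false) * (forall i, (m == g i) = false).
Proof.
have fg i j : (f i == g j) = false by exact: eq_lrshift.
have fm i : (f i == m) = false by exact: eq_lrshift.
have gm i : (g i == m) = false by rewrite /g /m eq_rshift eq_rlshift.
refine (_, _, fg, _, fm, _, gm, _) => *.
- exact: eq_lshift.
- by rewrite /g !eq_rshift.
- by rewrite eq_sym fg.
- by rewrite eq_sym fm.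
- by rewrite eq_sym gm.
Qed.

Lemma lift_edgeP u v : reflect
  ((exists i j, G i j /\ (u = f i /\ v = f j \/ u = g i /\ v = g j)) \/
   (exists2 i, i \in S &
      [\/ u = f i /\ v = m, u = m /\ v = f i, u = m /\ v = g i | u = g i /\ v = m]))
  (lift_edge G S u v).
Proof.
apply: (iffP orP) => [] [].
- move=> /existsP[i /existsP[j /andP[ij]]] uv; left; exists i, j; split; first exact: ij.
  by case/orP: uv => /andP[/eqP-> /eqP->]; [left|right].
- move=> /existsP[i /andP[iS uv]]; right; exists i; first exact: iS.
  by case/or4P: uv => /andP[/eqP-> /eqP->];
    [constructor 1|constructor 2|constructor 3|constructor 4].
- move=> [i [j [ij uv]]]; left; apply/existsP; exists i; apply/existsP; exists j.
  by rewrite ij; case: uv => [] [-> ->]; rewrite !eqxx ?orbT.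
- move=> [i iS uv]; right; apply/existsP; exists i; rewrite iS.
  by case: uv => [] [-> ->]; rewrite !eqxx ?orbT.
Qed.

Lemma lift_edge_copies :
  (forall i j, lift_edge G S (f i) (f j) = G i j) *
  (forall i j, lift_edge G S (g i) (g j) = G i j) *
  (forall i j, lift_edge G S (f i) (g j) = false) *
  (lift_edge G S m m = false) *
  (forall i, lift_edge G S (f i) m = (i \in S)) *
  (forall i, lift_edge G S m (g i) = (i \in S)).
Proof.
refine (_, _, _, _, _, _) => [i j|i j|i j||i|i].
all: apply: (sameP (lift_edgeP _ _)); apply: (iffP idP).
(* The even goals read an adjacency off an edge of the lift: comparing endpoints
   excludes all the edge shapes but one, and identifies its indices. *)
2,4,6,8,10,12: move=> [[a [b [ab [|]]]]|[a aS [|||]]] [] /eqP + /eqP;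
  rewrite !copy_eq ?eqxx //; do ?[by move=> /eqP-> /eqP->| by move=> _ /eqP-> | by move=> /eqP-> _].
all: try by [].
- by move=> ij; left; exists i, j; split; [exact: ij|left].
- by move=> ij; left; exists i, j; split; [exact: ij|right].
- by move=> iS; right; exists i; [exact: iS|constructor 1].
- by move=> iS; right; exists i; [exact: iS|constructor 3].
Qed.

Variant lift_vertex_spec : 'I_(N + (1 + N)) -> Prop :=
  | FstCopy i : lift_vertex_spec (f i)
  | MidVertex : lift_vertex_spec m
  | SndCopy i : lift_vertex_spec (g i).

Lemma lift_vertexP u : lift_vertex_spec u.
Proof.
rewrite -(splitK u); case: (split u) => [i|w]; first exact: FstCopy.
rewrite -(splitK w); case: (split w) => [o|i]; last exact: SndCopy.
by rewrite [o]ord1; exact: MidVertex.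
Qed.

Lemma adjacency_lift :
  adjacency_mx R (acikmese_lift G S) =
  block_mx A (row_mx s 0) (col_mx s^T 0) (block_mx 0 s^T s A).
Proof.
have edge_sym u v : lift_edge G S u v = lift_edge G S v u by exact: lift_edge_sym.
apply/matrixP => u v; rewrite mxE /=.
case: (lift_vertexP u) => [i||i]; case: (lift_vertexP v) => [j||j].
all: rewrite ?lift_edge_copies.
- by rewrite block_mxEul mxE.
- by rewrite block_mxEur row_mxEl mxE.
- by rewrite block_mxEur row_mxEr mxE.
- by rewrite edge_sym lift_edge_copies block_mxEdl col_mxEu !mxE.
- by rewrite block_mxEdr block_mxEul mxE.
- by rewrite block_mxEdr block_mxEur !mxE.
- by rewrite edge_sym lift_edge_copies block_mxEdl col_mxEd mxE.
- by rewrite edge_sym lift_edge_copies block_mxEdr block_mxEdl mxE.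
- by rewrite !block_mxEdr mxE.
Qed.

Lemma laplacian_lift :
  laplacian R (acikmese_lift G S) =
  block_mx L (row_mx (- s) 0)
    (col_mx (- s^T) 0) (block_mx (2 * #|S|%:R)%:M (- s^T) (- s) L).
Proof.
have s1 : s *m (const_mx 1 : 'M_1) = s.
  by apply/matrixP => i j; rewrite !mxE big_ord1 !mxE mulr1.
have sT1 : s^T *m (const_mx 1 : 'cV_N) = #|S|%:R%:M.
  apply/matrixP => i j; rewrite !mxE !ord1 eqxx mulr1n -sum1_card natr_sum [RHS]big_mkcond/=.
  by apply: eq_bigr => k _; rewrite !mxE mulr1; case: (k \in S).
have LE : L = diag_mx (A *m const_mx 1 + s)^T - A.
  by rewrite /L /loop_laplacian laplacianE linearD linearD/= addrAC.
have one_col : const_mx 1 =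
    col_mx (const_mx 1) (col_mx (const_mx 1) (const_mx 1)) :> 'cV[R]_(N + (1 + N)).
  by rewrite !col_mx_const.
rewrite laplacianE adjacency_lift one_col.
rewrite mul_block_col mul_row_col mul_col_mx mul_block_col s1 sT1.
rewrite !mul0mx addr0 add0r add_col_mx.
rewrite !tr_col_mx !diag_mx_row !opp_block_mx !add_block_mx opp_row_mx opp_col_mx.
rewrite !oppr0 !addr0 !add0r [s + _]addrC -LE; congr (block_mx _ _ _ (block_mx _ _ _ _)).
by apply/matrixP => i j; rewrite !mxE !ord1 eqxx !mulr1n mulrDl mul1r.
Qed.

(** The similarity comes from the symmetry that exchanges the two copies: the rows
of [P] are the antisymmetric basis vectors, the middle vertex, and the symmetric
basis vectors. *)
Lemma char_poly_lift :
  char_poly (laplacian R (acikmese_lift G S)) =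
  char_poly L * char_poly (M_sym R G S).
Proof.
have -> : char_poly L * char_poly (M_sym R G S)
        = char_poly (block_mx L 0 0 (M_sym R G S)).
  by rewrite /char_poly char_block_diag_mx det_ublock.
(* The symmetric rows are scaled by [r = 1 / sqrt 2], which is what makes the
   second diagonal block symmetric, namely [M_sym]. *)
pose w : R := Num.sqrt 2; pose r : R := w / 2.
have rDr : r + r = w by rewrite /r -splitr.
have halfD : 2^-1 + 2^-1 = 1 :> R by rewrite [RHS]splitr mul1r.
have wr : w * r = 1.
  by rewrite /r mulrA -expr2 sqr_sqrtr ?ler0n// divff ?pnatr_eq0.
pose P : 'M[R]_(N + (1 + N)) :=
  block_mx 1%:M (row_mx 0 (- 1%:M)) (col_mx 0 r%:M) (block_mx 1%:M 0 0 r%:M).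
pose Q : 'M[R]_(N + (1 + N)) :=
  block_mx (2^-1)%:M (row_mx 0 r%:M) (col_mx 0 (- 2^-1)%:M) (block_mx 1%:M 0 0 r%:M).
pose mulE := (@mulmx_block, @mul_row_col, @mul_row_block, @mul_block_col,
              @mul_col_row, @mul_mx_row, @mul_col_mx).
pose zeroE := (@mul0mx, @mulmx0, @mul1mx, @mulmx1, @addr0, @add0r).
have PQ : P *m Q = 1%:M.
  rewrite /P /Q !mulE ?zeroE.
  rewrite raddfN /= !mulNmx !mulmxN !opprK mul1mx -!scalar_mxM.
  rewrite add_row_mx add_row_mx add_col_mx add_block_mx ?zeroE subrr addrC.
  rewrite -!raddfD/= -mulrDl rDr wr halfD.
  by rewrite mul1r subrr row_mx0 col_mx0 -!scalar_mx_block.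
apply: (char_poly_similar (P := P)); first by case: (mulmx1_unit PQ).
rewrite laplacian_lift /P /M_sym -/s -/L -/w.
rewrite !mulE ?zeroE.
rewrite add_block_mx !row_mx0 !zeroE !add_row_mx !add_col_mx ?zeroE !mulmxN !mulNmx mul1mx mulmx1.
rewrite !mul_scalar_mx !mul_mx_scalar !opprK !scalerA [r * w]mulrC wr !scale1r.
by rewrite addNr -opprD -scalerDl rDr.
Qed.

End Lift.

(** * Comparison of the moments *)

(* e`_k is the paper's e_(k+1): the sums below are shifted by one. *)
Theorem theorem4p8 (R : realType) (N : nat) (G : sgraph N) (S : {set 'I_N})
    (S_gt0 : (1 <= #|S|)%N) (q : R) (q_gt0 : 0 < q) (c : R) :
  let e := eigenvalues (Phi q (laplacian R (acikmese_lift G S)) c) in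
  \sum_(N <= k < 2 * N + 1) e`_k - \sum_(0 <= k < N) e`_k
    <= moment q (M_sym R G S) c - moment q (loop_laplacian R G S) c
  /\ moment q (M_sym R G S) c - moment q (loop_laplacian R G S) c
    <= \sum_(0 <= k < N + 1) e`_k - \sum_(N + 1 <= k < 2 * N + 1) e`_k.
Proof.
move=> e; pose phi (x : R) := `|x - c| `^ q.
pose a := map phi (eigenvalues (loop_laplacian R G S)).
pose b := map phi (eigenvalues (M_sym R G S)).
have a_size : size a = N by rewrite size_map size_eigenvalues ?trmx_loop_laplacian.
have b_size : size b = (N + 1)%N.
  by rewrite size_map size_eigenvalues ?trmx_M_sym// addnC.
have e_ab : perm_eq e (a ++ b).
  have := perm_eigenvalues_spectral_fun phi (trmx_laplacian R (acikmese_lift G S)).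
  move=> /perm_trans; apply; rewrite -map_cat perm_map// perm_eigenvalues//.
  rewrite char_poly_lift big_cat/=.
  by rewrite -!char_poly_symmetric ?trmx_M_sym ?trmx_loop_laplacian.
have e_ba : perm_eq e (b ++ a) by rewrite (perm_trans e_ab)// perm_catC.
have e_sorted : sorted >=%R e by exact: eigenvalues_sorted.
have e_size : size e = (2 * N + 1)%N.
  by rewrite (perm_size e_ab) size_cat a_size b_size addnA mul2n addnn.
have N_le : (N + 1 <= size e)%N by rewrite e_size mul2n -addnn -addnA leq_addl.
have N_le' : (N <= size e)%N by rewrite (leq_trans _ N_le)// leq_addr.
have -> : moment q (M_sym R G S) c = \sum_(x <- b) x by rewrite big_map.
have -> : moment q (loop_laplacian R G S) c = \sum_(x <- a) x by rewrite big_map.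
rewrite -e_size !sum_nth_drop !sum_nth_take//.
have := sum_difference_le_take_drop e_sorted e_ab.
have := sum_difference_le_take_drop e_sorted e_ba.
rewrite a_size b_size => lower upper; split=> //.
by rewrite -lerN2 !opprB.
Qed.
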